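(* If $\kappa$ is a weakly ineffable cardinal, then the quasi-order $\sqsubseteq^{\mathrm{NS}}$ on $2^\kappa$ is $\Sigma^1_1$-complete.
   Context: $\kappa^\kappa$ carries the bounded topology (basic open sets $\{\eta\mid p\subset\eta\}$, $p\in\kappa^{<\kappa}$), $2^\kappa$ the subspace topology; Borel sets are generated from basic open sets by unions and intersections of length $\kappa$; a map between Borel subsets is Borel if preimages of open sets are Borel. A quasi-order $Q$ on a Borel $X\subseteq\kappa^\kappa$ is $\Sigma^1_1$ if it is the projection of a closed subset of $X^2\times\kappa^\kappa$; $Q_1$ on $X$ is Borel-reducible to $Q_2$ on $Y$ if some Borel $f\colon X\to Y$ satisfies $x_1Q_1x_2\iff f(x_1)Q_2f(x_2)$; a quasi-order is $\Sigma^1_1$-complete if every $\Sigma^1_1$ quasi-order is Borel-reducible to it. For $\eta,\xi\in2^\kappa$, $\eta\sqsubseteq^{\mathrm{NS}}\xi$ iff $\eta^{-1}\{1\}\setminus\xi^{-1}\{1\}$ is non-stationary in $\kappa$. *)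

(* Defs.v *)
From HB Require Import structures.
From mathcomp Require Import all_boot all_order.
From mathcomp Require Import boolp classical_sets functions cardinality.
From mathcomp Require Import topology.

Set Implicit Arguments.
Unset Strict Implicit.
Unset Printing Implicit Defensive.

Import Order.TTheory.
Local Open Scope order_scope.
Local Open Scope card_scope.
Local Open Scope classical_set_scope.

(* An infinite cardinal kappa is represented by a type K with a well-order of
   order type kappa: an ordinal a < kappa is an element of K, identified with
   its set [set b | b < a] of predecessors, and \bot is the ordinal 0. *)

Section Cardinals.
Context {d : Order.disp_t} {K : bOrderType d}.
Implicit Types (A C S : set K) (a b c : K).

Definition well_ordered_type :=
  forall A, A !=set0 -> exists2 a, A a & lbound A a.

Definition initial_ordinal :=
  forall a, ~~ ([set: K] #<= [set b | b < a]).

Definition unbounded A := ~ has_ubound A.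

Definition regular_uncountable_cardinal :=
  [/\ well_ordered_type, initial_ordinal, ~ countable [set: K]
    & forall A, unbounded A -> [set: K] #<= A].

(* Also called "almost ineffable" in the literature. *)
Definition weakly_ineffable :=
  regular_uncountable_cardinal /\
  forall F : K -> set K, (forall a, F a `<=` [set b | b < a]) ->
    exists A, [set a | A `&` [set b | b < a] = F a] #= [set: K].

Definition closed_in_kappa C :=
  forall a, \bot < a -> (forall b, b < a -> exists2 c, C c & b < c < a) -> C a.

Definition club C := unbounded C /\ closed_in_kappa C.

Definition stationary S := forall C, club C -> S `&` C !=set0.

(* The ordinal 1. *)
Definition is_one a := \bot < a /\ forall b, \bot < b -> a <= b.

End Cardinals.

Arguments well_ordered_type {d} K.
Arguments initial_ordinal {d} K.
Arguments regular_uncountable_cardinal {d} K.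
Arguments weakly_ineffable {d} K.

Definition gBaire d (K : bOrderType d) := K -> K.

HB.instance Definition _ d (K : bOrderType d) :=
  Choice.copy (gBaire K) (K -> K).

Section BoundedTopology.
Context {d : Order.disp_t} {K : bOrderType d}.
Implicit Types (p x : gBaire K) (a : K) (U V : set (gBaire K)).

(* The basic open set given by the restriction of p to a; since kappa is a limit
   ordinal, every element of kappa^{<kappa} is such a restriction. *)
Definition basic_open p a : set (gBaire K) :=
  [set x | forall b, b < a -> x b = p b].

Definition bounded_open U := forall x, U x -> exists a, basic_open x a `<=` U.

Lemma bounded_openT : bounded_open setT.
Proof. by move=> x _; exists \bot. Qed.

Lemma bounded_openI U V :
  bounded_open U -> bounded_open V -> bounded_open (U `&` V).
Proof.
move=> oU oV x [/oU[a aU] /oV[b bV]]; exists (Order.max a b) => y xy.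
by split; [apply: aU|apply: bV] => c lc; apply: xy; rewrite lt_max lc ?orbT.
Qed.

Lemma bounded_open_bigU (I : Type) (F : I -> set (gBaire K)) :
  (forall i, bounded_open (F i)) -> bounded_open (\bigcup_i F i).
Proof.
move=> oF x [i _ /oF[a aF]]; exists a => y /aF Fy.
by exists i.
Qed.

HB.instance Definition _ := isOpenTopological.Build (gBaire K)
  bounded_openT bounded_openI bounded_open_bigU.

End BoundedTopology.

Section Borel.
Context {d : Order.disp_t} {K : bOrderType d}.

Inductive borel : set (gBaire K) -> Prop :=
| borel_basic p a : borel (basic_open p a)
| borel_bigcup (F : K -> set (gBaire K)) :
    (forall a, borel (F a)) -> borel (\bigcup_a F a)
| borel_bigcap (F : K -> set (gBaire K)) :
    (forall a, borel (F a)) -> borel (\bigcap_a F a).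

Implicit Types (X Y : set (gBaire K)) (Q R : gBaire K -> gBaire K -> Prop).

(* A map from X to Y is a total function sending X into Y; its values outside X
   are irrelevant.  Open subsets of Y are traces of open sets. *)
Definition borel_map X Y (f : gBaire K -> gBaire K) :=
  (forall x, X x -> Y (f x)) /\
  forall U, open U -> borel (X `&` f @^-1` U).

(* Relations on X are relations on the whole space, of which only the
   restriction to X matters. *)
Definition quasi_order_on X Q :=
  [/\ borel X,
      forall x, X x -> Q x x
    & forall x y z, X x -> X y -> X z -> Q x y -> Q y z -> Q x z].

(* The closed subsets of X^2 * kappa^kappa are the traces of the closed subsets
   of the full product. *)
Definition Sigma11 X Q :=
  exists2 C : set (gBaire K * gBaire K * gBaire K), closed C &
    forall x y, X x -> X y -> (Q x y <-> exists z, C (x, y, z)).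

Definition borel_reducible X Q Y R :=
  exists2 f, borel_map X Y f &
    forall x y, X x -> X y -> (Q x y <-> R (f x) (f y)).

Definition Sigma11_complete Y R :=
  quasi_order_on Y R /\
  forall X Q, quasi_order_on X Q -> Sigma11 X Q -> borel_reducible X Q Y R.

End Borel.

(* 2^kappa, as a subset of kappa^kappa. *)
Definition gCantor d (K : bOrderType d) : set (gBaire K) :=
  [set x | forall a, x a = \bot \/ is_one (x a)].

Definition sub_NS d (K : bOrderType d) (x y : gBaire K) : Prop :=
  ~ stationary ([set a | is_one (x a)] `\` [set a | is_one (y a)]).

(* Main.v *)
(* A Sigma^1_1 quasi-order Q on X, intersected with X^2, is the projection of a
   closed set D.  For [a < kappa], the initial parts of D below [a] define a
   relation on [a ^ a]; let Q_a be its reflexive transitive closure, which is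
   witnessed by finitely many functions [a -> a].  If Q x y
   then Q_a x|a y|a on a club.  If not Q x y, weak ineffability gives
   stationarily many [a] with not Q_a x|a y|a: otherwise the witnesses at the
   points of a club would cohere to a chain from x to y.

   This reflection can be combined with guessing.  Let g_a be, by recursion, the
   first function of a triple (x, y, C) chosen at [a] such that C is club in [a],
   not Q_a x y, and no b in C satisfies g_b = x|b and not Q_b x|b y|b.  If the
   triples chosen at [a < a'] cohere, then [a] belongs to the club chosen at
   [a'] and contradicts the choice there; so g guesses every x at stationarily
   many [a] with not Q_a x|a y|a, for every y with not Q x y.  Transitivity of
   Q_a then shows that [x |-> {a | Q_a g_a x|a}] reduces Q to inclusion modulo
   the non-stationary ideal.  Open sets are Borel because the restrictions of
   the g_a already exhaust kappa^{<kappa}. *)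

Require Import Defs.
From mathcomp Require Import all_boot all_order.
From mathcomp Require Import boolp classical_sets functions cardinality.
From mathcomp Require Import topology.

Set Implicit Arguments.
Unset Strict Implicit.
Unset Printing Implicit Defensive.

Import Order.TTheory.
Local Open Scope order_scope.
Local Open Scope card_scope.
Local Open Scope classical_set_scope.

(** The condition at [t] sees only the values below [t], so the partial function available there can
    be completed by the default [v0]. *)
Lemma wf_choice (T V : Type) (R : T -> T -> Prop)
    (P : T -> (T -> V) -> V -> Prop) :
  V -> well_founded R ->
  (forall t f f' v, (forall s, R s t -> f s = f' s) -> P t f v -> P t f' v) ->
  (forall t f, exists v, P t f v) ->
  exists f, forall t, P t f (f t).
Proof.
move=> v0 wfR Pext /(_ _ _)/cid-Pex.
pose ext t (rec : forall s, R s t -> V) s :=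
  if pselect (R s t) is left r then rec s r else v0.
pose step t rec := projT1 (Pex t (ext t rec)).
pose f := Fix wfR (fun=> V) step.
have fE t : f t = step t (fun s _ => f s).
  rewrite /f Fix_eq// => s g g' gg'; congr step.
  by apply: functional_extensionality_dep => r; apply/funext => /= ?; exact: gg'.
exists f => t; rewrite fE /step; case: (Pex _ _) => v /= Pv.
apply: Pext Pv => s Rst; rewrite /ext; by case: pselect.
Qed.

(** * Regular uncountable cardinals: bounds, coding of pairs, clubs *)

Section RegularCardinal.
Context {d : Order.disp_t} {K : bOrderType d}.
Implicit Types (a b c m : K) (h x y : K -> K) (A C S : set K).

Definition agree a x y := forall b, b < a -> x b = y b.

(** For regular uncountable kappa these sets are club and every club contains one, so functions can
    stand for clubs. *)
Definition closure_points h : set K :=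
  [set a | \bot < a /\ forall b, b < a -> h b < a].

Hypothesis Kreg : regular_uncountable_cardinal K.

Let Kwo : well_ordered_type K. Proof. by case: Kreg. Qed.

Lemma lt_wf : well_founded (fun a b => a < b).
Proof.
move=> a; apply: contrapT => nacc.
have [m nm mmin] := Kwo (ex_intro (fun a => ~ Acc (fun a b => a < b) a) a nacc).
apply: nm; constructor=> b bm; apply: contrapT => /mmin; by rewrite leNgt bm.
Qed.

(** A maximum [a] could be absorbed by the infinite segment below it, against the initiality of
    kappa. *)
Lemma exists_gt a : exists b, a < b.
Proof.
apply: contrapT => amax.
have amaxP b : b = a \/ b < a.
  have [->|nba] := eqVneq b a; [by left|right].
  rewrite lt_neqAle nba leNgt; apply/negP => ab; apply: amax; by exists b.
have [_ /(_ a)/negP Kinit Kunc _] := Kreg; apply: Kinit.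
have /infiniteP/card_leP[g] : infinite_set [set b | b < a].
  have -> : [set b | b < a] = [set: K] `\` [set a].
    apply/seteqP; split => b /=; last by case=> _; case: (amaxP b).
    by move=> ba; split=> // bE; move: ba; rewrite bE ltxx.
  apply: infinite_setD (finite_set1 _) => /finite_set_countable; exact: Kunc.
have [f fa f_inj] : exists2 f : nat -> K, forall n, f n < a & injective f.
  exists (fun n => set_val (g (to_setT n))) => [n|m n /val_inj].
    exact: set_valP (g (to_setT n)).
  by move/(inj (mem_setT _) (mem_setT _)); move/(congr1 set_val).
(* Hilbert's hotel: [r] shifts the sequence [f] back by one, sends [f 0] to [a] and fixes all else,
   so it maps the segment below [a] onto kappa. *)
pose r b := if pselect (exists2 n, b = f n.+1 & True) is left e
            then f (projT1 (cid2 e))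
            else if b == f 0%N then a else b.
have fS n : r (f n.+1) = f n.
  rewrite /r; case: pselect => [e|[]]; last by exists n.
  case: cid2 => m /= + _; by move/f_inj => [->].
have f0 : r (f 0%N) = a.
  rewrite /r eqxx; case: pselect => // e; exfalso; case: e => m + _.
  by move/f_inj.
apply: card_le_trans (card_image_le r _); apply: subset_card_le => b _ /=.
have [bf|nbf] := pselect (exists n, b = f n).
  by case: bf => n ->; exists (f n.+1).
case: (amaxP b) => [->|ba]; first by exists (f 0%N).
exists b => //; rewrite /r; case: pselect => [e|_].
  by exfalso; apply: nbf; case: e => m -> _; exists m.+1.
by case: eqP => // bE; exfalso; apply: nbf; exists 0%N.
Qed.

Lemma small_bounded A : ~ ([set: K] #<= A) ->
  exists m, \bot < m /\ forall a, A a -> a < m.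
Proof.
have [_ _ _ Kr] := Kreg => /(contra_not (Kr A)) /contrapT[m mA].
have [m' mm'] := exists_gt m; exists m'; split.
  exact: le_lt_trans (le0x m) mm'.
by move=> a /mA am; apply: le_lt_trans mm'.
Qed.

Lemma segment_bounded a h : exists m, \bot < m /\ forall b, b < a -> h b < m.
Proof.
have [m [m0 hm]] : exists m, \bot < m /\
    forall c, (h @` [set b | b < a]) c -> c < m.
  apply: small_bounded => /card_le_trans/(_ (card_image_le _ _)).
  by have [_ /(_ a)/negP] := Kreg.
by exists m; split=> // b ba; apply: hm; exists b.
Qed.

Lemma countable_bounded (I : countType) (u : I -> K) :
  exists m, \bot < m /\ forall i, u i < m.
Proof.
have [m [m0 um]] : exists m, \bot < m /\ forall c, range u c -> c < m.
  apply: small_bounded => /card_le_trans/(_ (card_image_le _ _)) /card_le_trans.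
  by move/(_ _ _ (countableP _)); have [_ _] := Kreg.
by exists m; split=> // i; apply: um; exists i.
Qed.

Lemma square_bounded a (q : K -> K -> K) :
  exists m, \bot < m /\ forall b c, b < a -> c < a -> q b c < m.
Proof.
have /choice[r rP] := fun b => segment_bounded a (q b).
have [m [m0 rm]] := segment_bounded a r; exists m; split=> // b c ba ca.
by apply: lt_trans (rm _ ba); case: (rP b) => _; apply.
Qed.

(* Goedel's well-order of pairs, whose proper initial segments are contained in
   squares of initial segments. *)
Definition pair_lt (p q : K * K) := let max p := Order.max p.1 p.2 in
  max p < max q \/ (max p = max q /\ (p.1 < q.1 \/ (p.1 = q.1 /\ p.2 < q.2))).

Lemma pair_lt_wf : well_founded pair_lt.
Proof.
suff H m b c : Order.max b c = m -> Acc pair_lt (b, c).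
  by move=> [b c]; exact: H erefl.
elim/(well_founded_ind lt_wf): m b c => m IHm.
elim/(well_founded_ind lt_wf) => b IHb.
elim/(well_founded_ind lt_wf) => c IHc bcm.
constructor=> -[b' c']; rewrite /pair_lt /= bcm => -[lm|[em]].
  exact: IHm lm _ _ erefl.
by case=> [lb|[eb lc]]; [exact: IHb|rewrite eb; apply: IHc => //; rewrite -eb].
Qed.

Lemma pair_lt_total p q : pair_lt p q \/ p = q \/ pair_lt q p.
Proof.
case: p q => [b c] [b' c']; rewrite /pair_lt /=.
have [?|?|mE] := ltgtP (Order.max b c); [by left; left|by right; right; left|].
move: mE; have [?|?|->] := ltgtP b => mE; [by left; right; split=> //; left| |].
  by right; right; right; split=> //; left.
have [?|?|->] := ltgtP c; last by right; left.
- by left; right; split=> //; right.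
- by right; right; right; split=> //; right.
Qed.

(** By recursion along [pair_lt]: the predecessors of a pair lie in a square, so their values are
    bounded by regularity. The map is strictly increasing, hence injective. The value [\bot] is
    avoided because [coherent] uses it as a marker. *)
Lemma pairing : exists p : K * K -> K, injective p /\ forall s, \bot < p s.
Proof.
have [p pP] : exists p : K * K -> K,
    forall s, \bot < p s /\ forall t, pair_lt t s -> p t < p s.
  apply: (wf_choice (P := fun s p v => \bot < v /\ forall t, pair_lt t s -> p t < v)
    \bot pair_lt_wf) => [s p p' v pp' [v0 pv]|[b c] p].
    by split=> // t ts; rewrite -pp'//; exact: pv.
  have [m bcm] := exists_gt (Order.max b c).
  have [v [v0 pv]] := square_bounded m (fun b c => p (b, c)).
  exists v; split=> // -[b' c'] ts.
  suff : Order.max b' c' < m by rewrite gt_max => /andP[]; exact: pv.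
  by case: ts => [/lt_trans|[->]//]; apply.
exists p; split=> [s t pst|s]; last by case: (pP s).
case: (pair_lt_total s t) => [st|[//|ts]].
  by have := (pP t).2 _ st; rewrite pst ltxx.
by have := (pP s).2 _ ts; rewrite pst ltxx.
Qed.

Lemma unpairing : exists (p : K -> K -> K) (p1 p2 : K -> K),
  forall a b, p1 (p a b) = a /\ p2 (p a b) = b.
Proof.
have [p [p_inj _]] := pairing.
have /choice[q qP] c : exists s, forall t, p t = c -> s = t.
  have [[s ps]|np] := pselect (exists s, p s = c).
    by exists s => t; rewrite -ps => /p_inj.
  by exists (\bot, \bot) => t pt; exfalso; apply: np; exists t.
exists (fun a b => p (a, b)), (fst \o q), (snd \o q) => a b /=.
by rewrite (qP _ (a, b) erefl).
Qed.

(** Labels enter through an increasing sequence [i], which is bounded because kappa has uncountable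
    cofinality; this makes the bound on codes uniform in the label. *)
Lemma coding (L : countType) : exists e : L -> K -> K -> K,
  [/\ forall l b c l' b' c', e l b c = e l' b' c' -> [/\ l = l', b = b' & c = c'],
      forall l b c, \bot < e l b c
    & forall a, exists m, forall l b c, b < a -> c < a -> e l b c < m].
Proof.
have [p [p_inj p0]] := pairing.
pose i := fix i n : K := if n is n'.+1 then projT1 (cid (exists_gt (i n'))) else \bot.
have iS n : i n < i n.+1 by rewrite /=; case: cid.
have i_inj : injective i.
  suff ilt k n : (k < n)%N -> i k < i n.
    by move=> k n ikn; case: (ltngtP k n) => // /ilt; rewrite ikn ltxx.
  elim: n => // n IHn; rewrite ltnS leq_eqVlt => /predU1P[->//|/IHn ilt].
  exact: lt_trans ilt (iS n).
exists (fun l b c => p (p (i (pickle l), b), c)); split=> //.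
  move=> l b c l' b' c' /p_inj[/p_inj[/i_inj/(pcan_inj pickleK) -> ->] ->].
  by [].
move=> a; have [w [_ iw]] := countable_bounded i.
have [m [_ pm]] := square_bounded (Order.max w a) (fun b c => p (b, c)).
have [m' [_ pm']] := square_bounded (Order.max m a) (fun b c => p (b, c)).
exists m' => l b c ba ca; apply: pm'; rewrite lt_max ?ca ?orbT//.
by rewrite pm// lt_max ?iw ?ba ?orbT.
Qed.

(** Above any [a], the supremum of countably many iterates of a function dominating [h] is a closure
    point of [h]. *)
Lemma closure_points_club h : club (closure_points h).
Proof.
split=> [[a ha]|a a0 ha]; last first.
  split=> // b ba; have [c [_ hc] /andP[bc ca]] := ha _ ba.
  exact: lt_trans (hc _ bc) ca.
have /choice[g gP] b : exists m, b < m /\ forall c, c < b -> h c < m.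
  have [m [_ hm]] := segment_bounded b h; have [m' bm'] := exists_gt b.
  exists (Order.max m m'); split=> [|c cb]; first by rewrite lt_max bm' orbT.
  by rewrite lt_max hm.
pose u n := iter n g a.
have uS n : u n < u n.+1 by rewrite /u iterS; case: (gP (iter n g a)).
have [m [_ um]] := countable_bounded u.
have [e ue emin] := Kwo (ex_intro (fun m => forall n, u n < m) m um).
have : e <= a.
  apply: ha; split; first exact: le_lt_trans (le0x _) (ue 0%N).
  move=> b be.
  have [n bn] : exists n, b < u n.
    apply: contrapT => nb; have /emin : forall n, u n < b.
      move=> n; apply: lt_le_trans (uS n) _; rewrite leNgt; apply/negP => bu.
      by apply: nb; exists n.+1.
    by rewrite leNgt be.
  apply: lt_trans (ue n.+1); rewrite /u iterS.
  by case: (gP (iter n g a)) => _; exact.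
by rewrite leNgt (ue 0%N).
Qed.

Lemma club_next C : club C -> exists h, forall b, C (h b) /\ b < h b.
Proof.
move=> [Cunb _]; suff /choice[h hP] : forall b, exists c, C c /\ b < c by exists h.
move=> b.
apply: contrapT => nc; apply: Cunb; exists b => c Cc.
by rewrite leNgt; apply/negP => bc; apply: nc; exists c.
Qed.

Lemma closure_points_sub_club C : club C -> exists h, closure_points h `<=` C.
Proof.
move=> clubC; have [h hP] := club_next clubC.
exists h => a [a0 ha]; apply: clubC.2 => // b ba.
by have [? ?] := hP b; exists (h b) => //; apply/andP; split=> //; exact: ha.
Qed.

Lemma nonstationaryP S :
  ~ stationary S <-> exists h, S `&` closure_points h = set0.
Proof.
split=> [nS|[h Sh] /(_ _ (closure_points_club h))]; last first.
  by rewrite Sh => -[].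
apply: contrapT => nh; apply: nS => C /closure_points_sub_club[h hC].
apply/set0P/eqP => SC; apply: nh; exists h.
by apply/seteqP; split=> // a [Sa /hC Ca]; rewrite -SC; split.
Qed.

Lemma closure_points_max h h' a : closure_points (fun b => Order.max (h b) (h' b)) a ->
  closure_points h a /\ closure_points h' a.
Proof.
by move=> [a0 ha]; split; split=> // b /ha; rewrite gt_max => /andP[].
Qed.

End RegularCardinal.

Section WeaklyIneffable.
Context {d : Order.disp_t} {K : bOrderType d}.
Implicit Types (a b c m : K) (h x y : K -> K) (A C S : set K).
Hypothesis Kwi : weakly_ineffable K.
Let Kreg := Kwi.1.

Lemma coherent_subset (F : K -> set K) : (forall a, F a `<=` [set b | b < a]) ->
  exists A, forall m, exists2 a, m < a & A `&` [set b | b < a] = F a.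
Proof.
move=> /(Kwi.2 F)[A AK]; exists A => m; apply: contrapT => nm.
have [m' mm'] := exists_gt Kreg m.
have [_ /(_ m')/negP Kinit _ _] := Kreg; apply: Kinit.
move: AK; rewrite card_eq_le => /andP[_ /card_le_trans]; apply.
apply: subset_card_le => a /= aA; apply: le_lt_trans mm'; rewrite leNgt.
by apply/negP => ma; apply: nm; exists a.
Qed.

(** The part of [P a] below [a] is coded as a subset of [a], and [H] consists of the points where
    these subsets cohere. Weak ineffability makes [H] only unbounded, so it cannot simply be
    intersected with a club; instead, points that are not closed are given subsets that cannot
    cohere. *)
Lemma coherent (L : countType) h (P : K -> L -> K -> K -> Prop) :
  exists H : set K, [/\ forall m, exists2 a, H a & m < a, H `<=` closure_points h
    & forall a a' l b c, H a -> H a' -> b < a -> c < a -> b < a' -> c < a' ->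
        P a l b c -> P a' l b c].
Proof.
have [e [e_inj e0 /choice[he heP]]] := coding Kreg L.
have /choice[up upP] := exists_gt Kreg.
(* The bound [he m] covers arguments strictly below [m], hence [up]. *)
pose h' b := Order.max (h b) (he (up b)).
have eP a : closure_points h' a -> forall l b c, b < a -> c < a -> e l b c < a.
  move=> /closure_points_max[_ [_ hea]] l b c ba ca.
  have /hea : Order.max b c < a by rewrite gt_max ba.
  by apply: lt_trans; apply: heP; apply: le_lt_trans (upP _);
    rewrite le_max lexx ?orbT.
(* At a point [a] that is not closed under [h'], the set [F a] records some
   [b < a] with [a <= h' b]; the element [\bot] marks such sets. *)
have /choice[r rP] a : exists b,
    ~ closure_points h' a -> \bot < a -> b < a /\ a <= h' b.
  have [?|na] := pselect (closure_points h' a); first by exists \bot.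
  have [a0|na0] := pselect (\bot < a); last by exists \bot.
  apply: contrapT => nb; apply: na; split=> // b ba; rewrite ltNge; apply/negP.
  by move=> ab; apply: nb; exists b.
pose F a : set K := if pselect (closure_points h' a) is left _
  then [set s | s < a /\ exists l b c, s = e l b c /\ P a l b c]
  else [set s | s < a /\ (s = \bot \/ s = r a)].
have Fsub a : F a `<=` [set b | b < a] by rewrite /F; case: pselect => _ s [].
have [A AP] := coherent_subset Fsub.
have {}AP m : exists2 a, m < a & forall s, s < a -> (A s <-> F a s).
  by have [a ma AF] := AP m; exists a => // s sa; rewrite -AF; split=> [|[]].
(* Otherwise the coherent points [a] are not closed and [A] is [{\bot, r a}] below [a]. For large
   [a] this forces [r a] to be one nonzero ordinal, while [h' (r a)] bounds [a]: a contradiction. *)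
have Abot : ~ A \bot.
  move=> A0.
  have Fr a s : (forall s, s < a -> (A s <-> F a s)) -> \bot < a -> s < a ->
      A s <-> (s = \bot \/ s = r a).
    move=> AF a0 sa; have := AF _ a0; have := AF _ sa; rewrite /F.
    case: pselect => [_ _ [/(_ A0)[_ [l [b [c [be]]]]]]|_ -> _].
      by have := e0 l b c; rewrite -be ltxx.
    by split=> [[]|].
  have rlt a : (forall s, s < a -> (A s <-> F a s)) -> \bot < a ->
      r a < a /\ a <= h' (r a).
    move=> AF a0; apply: rP => // ca; have := AF _ a0; rewrite /F.
    case: pselect => // _ [/(_ A0)[_ [l [b [c [be]]]]]].
    by have := e0 l b c; rewrite -be ltxx.
  have [a ha AFa] := AP (h' \bot).
  have a0 : \bot < a by apply: le_lt_trans ha.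
  have [ra har] := rlt _ AFa a0.
  have [a' + AFa'] := AP (Order.max (h' (r a)) a).
  rewrite gt_max => /andP[ha' aa'].
  have a'0 : \bot < a' by apply: lt_trans aa'.
  have [ra' har'] := rlt _ AFa' a'0.
  have /(Fr _ _ AFa' a'0 (lt_trans ra aa')) : A (r a).
    by apply/(Fr _ _ AFa a0 ra); right.
  case=> [ra0|rE]; first by move: har; rewrite ra0 leNgt ha.
  by move: har'; rewrite -rE leNgt ha'.
exists [set a | \bot < a /\ forall s, s < a -> (A s <-> F a s)].
have Hcl a : \bot < a -> (forall s, s < a -> (A s <-> F a s)) ->
    closure_points h' a.
  move=> a0 AF; apply: contrapT => na; apply: Abot; apply/(AF _ a0).
  by rewrite /F; case: pselect => // _; split=> //; left.
split=> [m|a [a0 AF]|a a' l b c [a0 AF] [a'0 AF'] ba ca ba' ca' Pa].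
- by have [a ma AF] := AP m; exists a => //; split=> //; apply: le_lt_trans ma.
- by have /closure_points_max[] := Hcl _ a0 AF.
have ca1 := Hcl _ a0 AF; have ca2 := Hcl _ a'0 AF'.
have : A (e l b c).
  apply/AF; first exact: eP.
  by rewrite /F; case: pselect => // _; split; [exact: eP|exists l, b, c].
move/(AF' _ (eP _ ca2 _ _ _ ba' ca')); rewrite /F; case: pselect => // _.
by move=> [_ [l' [b' [c' [/e_inj[-> -> ->]]]]]].
Qed.

End WeaklyIneffable.

(** * Chains on initial segments *)

Section LocalChains.
Context {d : Order.disp_t} {K : bOrderType d}.
Implicit Types (a b c : K) (h x y z w : K -> K).
Implicit Types (D : (K -> K) -> (K -> K) -> (K -> K) -> Prop).

Definition near_rel D a x y w := exists x' y' w',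
  [/\ agree a x x', agree a y y', agree a w w' & D x' y' w'].

(** Such a [D] is the set of branches through the tree of its initial parts. *)
Definition closed_rel D := forall x y w, (forall a, near_rel D a x y w) -> D x y w.

(** Values are kept below [a] because [coherent] transfers only such values from one point to
    another. *)
Definition chain D a n (U W : nat -> K -> K) :=
  (forall i b, b < a -> U i b < a /\ W i b < a) /\
  forall i b, (i < n)%N -> b < a -> near_rel D b (U i) (U i.+1) (W i).

(* The transitive closure of the trace on [a] of the relation that is the
   projection of [D]. *)
Definition local_rel D a x y := exists n U W,
  [/\ chain D a n U W, agree a (U 0%N) x & agree a (U n) y].

Lemma agreeC a x y : agree a x y -> agree a y x.
Proof. by move=> xy b /xy. Qed.

Lemma agree_trans a x y z : agree a x y -> agree a y z -> agree a x z.
Proof. by move=> xy yz b ba; rewrite xy// yz. Qed.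

Lemma agree_le a b x y : b <= a -> agree a x y -> agree b x y.
Proof. by move=> ba xy c cb; apply: xy; exact: lt_le_trans ba. Qed.

Lemma near_rel_agree D a x y w x' y' w' :
  agree a x' x -> agree a y' y -> agree a w' w ->
  near_rel D a x y w -> near_rel D a x' y' w'.
Proof.
move=> xx yy ww [x1 [y1 [w1 [x1P y1P w1P D1]]]]; exists x1, y1, w1.
by split=> //; [exact: agree_trans x1P|exact: agree_trans y1P|exact: agree_trans w1P].
Qed.

Lemma local_rel_agree D a x y x' y' : agree a x x' -> agree a y y' ->
  local_rel D a x y -> local_rel D a x' y'.
Proof.
move=> xx yy [n [U [W [ch U0 Un]]]]; exists n, U, W.
by split=> //; [exact: agree_trans xx|exact: agree_trans yy].
Qed.

Lemma local_rel_refl D a x : (forall b, b < a -> x b < a) -> local_rel D a x x.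
Proof. by move=> xa; exists 0%N, (fun=> x), (fun=> x); split=> //; split=> // i b /xa. Qed.

Lemma local_rel_step D a x y z w : (forall b, b < a -> z b < a /\ w b < a) ->
  D y z w -> local_rel D a x y -> local_rel D a x z.
Proof.
move=> zwa Dyzw [n [U [W [[UWa UWn] U0 Un]]]].
exists n.+1, (fun i => if (i <= n)%N then U i else z),
  (fun i => if (i < n)%N then W i else w).
split=> //; last by rewrite ltnn.
split=> [i b ba|i b].
  have [zb wb] := zwa _ ba; have [Ub Wb] := UWa i _ ba.
  by case: ifP; case: ifP.
rewrite ltnS leq_eqVlt => /predU1P[->|i_n] ba /=; last first.
  by rewrite i_n orbT; exact: UWn.
(* The old chain ends in a function that agrees with [y] only below [a], which is enough for the
   initial parts that the new link tests. *)
rewrite eqxx ltnn; exists y, z, w; split=> //.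
exact: agree_le (ltW ba) Un.
Qed.

End LocalChains.

(** * Guessing combined with reflection *)

Section Diamond.
Context {d : Order.disp_t} {K : bOrderType d}.
Implicit Types (a b c : K) (h x y z w : K -> K) (C : set K).
Implicit Types (D : (K -> K) -> (K -> K) -> (K -> K) -> Prop).

Definition counterexample D a (g : K -> K -> K) x y C :=
  [/\ forall b, b < a -> x b < a /\ y b < a,
      forall b, b < a -> exists2 c, C c & b < c < a,
      forall b, \bot < b -> b < a ->
        (forall c, c < b -> exists2 e, C e & c < e < b) -> C b,
      ~ local_rel D a x y
    & forall b, b < a -> C b -> agree b (g b) x -> local_rel D b x y].

Hypothesis Kwi : weakly_ineffable K.
Let Kreg := Kwi.1.

(** The set [S] certifies that no finite chain of [D] leads from [x] to [y]; this covers both the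
    given quasi-order and the empty [D], for which the statement is a plain guessing principle. *)
Lemma diamond D : closed_rel D -> exists g : K -> K -> K,
  forall x y (S : set (K -> K)), S x -> ~ S y ->
    (forall u v w, S u -> D u v w -> S v) ->
  forall C, club C ->
    exists a, [/\ C a, agree a (g a) x & ~ local_rel D a x y].
Proof.
move=> Dcl.
pose V := ((K -> K) * (K -> K) * set K)%type.
pose cex a (f : K -> V) (v : V) :=
  counterexample D a (fun b => (f b).1.1) v.1.1 v.1.2 v.2.
have [f fP] : exists f : K -> V, forall a v, cex a f v -> cex a f (f a).
  have cex_ext a f f' v : (forall b, b < a -> f b = f' b) ->
      cex a f v -> cex a f' v.
    move=> ff' [? ? ? ? vf]; split=> // b ba; rewrite -ff'//; exact: vf.
  apply: (wf_choice (P := fun a f v => forall v', cex a f v' -> cex a f v)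
    ((id, id, set0) : V) (lt_wf Kreg)) => [a f f' v ff' vP v' v'P|a f].
    apply: (cex_ext _ _ _ _ ff'); apply: vP.
    by apply: cex_ext v'P => b ba; rewrite ff'.
  have [[v vP]|nv] := pselect (exists v, cex a f v); first by exists v.
  by exists (id, id, set0) => v vP; exfalso; apply: nv; exists v.
exists (fun a => (f a).1.1) => x y S Sx Sy SD C clubC.
apply: contrapT => nex.
have {}nex a : C a -> agree a (f a).1.1 x -> local_rel D a x y.
  by move=> Ca ax; apply: contrapT => nl; apply: nex; exists a.
have [nx nxP] := club_next clubC.
have /choice[N NP] a : exists N : nat * (nat -> K -> K) * (nat -> K -> K),
    local_rel D a x y ->
    [/\ chain D a N.1.1 N.1.2 N.2, agree a (N.1.2 0%N) x
      & agree a (N.1.2 N.1.1) y].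
  have [[n [U [W NP]]]|?] := pselect (local_rel D a x y).
    by exists (n, U, W).
  by exists (0%N, fun=> x, fun=> x).
(* All data at [a] are made coherent at once: the chosen triple under labels [(0, _)], the chain
   length as the label [(1, n)] itself, and the functions of the chain under [(2, i)] and
   [(3, i)]. *)
pose P a (l : nat * nat) b c : Prop := match l with
  | (0, 0) => (f a).2 b
  | (0, 1) => (f a).1.1 b = c
  | (0, _) => (f a).1.2 b = c
  | (1, n) => (N a).1.1 = n
  | (2, i) => (N a).1.2 i b = c
  | (_, i) => (N a).2 i b = c
  end%N.
have [H [Hunb Hcl HP]] :=
  coherent Kwi (fun b => Order.max (x b) (Order.max (y b) (nx b))) P.
(* The value at the smaller of the two points lies below both, so that one is transferred. *)
have graphE (F : K -> K -> K) l a a' b : (forall a b c, P a l b c = (F a b = c)) ->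
    H a -> H a' -> F a b < a -> F a' b < a' -> b < a -> b < a' -> F a b = F a' b.
  move=> FP Ha Ha' Fa Fa' ba ba'; have [aa'|/ltW aa'] := leP a a'.
    suff : P a' l b (F a b) by rewrite FP.
    by apply: HP Ha Ha' ba Fa ba' (lt_le_trans Fa aa') _; rewrite FP.
  suff : P a l b (F a' b) by rewrite FP.
  by apply: HP Ha' Ha ba' Fa' ba (lt_le_trans Fa' aa') _; rewrite FP.
have {}Hcl a : H a -> [/\ \bot < a, forall b, b < a -> x b < a,
    forall b, b < a -> y b < a & forall b, b < a -> nx b < a].
  move=> /Hcl/(closure_points_max (h := x))[[a0 xa]].
  by move=> /(closure_points_max (h := y))[[_ ya] [_ na]].
pose H2 a := H a /\ ~ local_rel D a x y.
(* The triple [(x, y, C)] is a counterexample at [a], so the chosen [f a] is one too, though perhaps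
   a different one. *)
have H2P a : H2 a -> cex a f (f a).
  move=> [/Hcl[a0 xa ya na] nl]; apply: (fP _ (x, y, C)); split=> //=.
  - by move=> b ba; split; [exact: xa|exact: ya].
  - by move=> b ba; have [? ?] := nxP b; exists (nx b) => //; apply/andP; split=> //; exact: na.
  - by move=> b b0 _ /(clubC.2 _ b0).
  - by move=> b _; exact: nex.
have H2lt a a' : H2 a -> H2 a' -> ~ a < a'.
  move=> Ha Ha' aa'; have [a0 _ _ _] := Hcl _ Ha.1.
  have [gxya Ca _ nla _] := H2P _ Ha.
  have [gxya' _ clCa' _ la'] := H2P _ Ha'.
  have gx : agree a (f a).1.1 (f a').1.1.
    move=> b ba; have ba' := lt_trans ba aa'.
    by apply: (graphE (fun a b => (f a).1.1 b) (0, 1)%N _ _ _ _ Ha.1 Ha'.1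
      (gxya _ ba).1 (gxya' _ ba').1 ba ba').
  have gy : agree a (f a).1.2 (f a').1.2.
    move=> b ba; have ba' := lt_trans ba aa'.
    by apply: (graphE (fun a b => (f a).1.2 b) (0, 2)%N _ _ _ _ Ha.1 Ha'.1
      (gxya _ ba).2 (gxya' _ ba').2 ba ba').
  apply: nla; apply: local_rel_agree (agreeC gx) (agreeC gy) _.
  apply: (la' _ aa' _ gx); apply: (clCa' _ a0 aa') => c /Ca[e Ce /andP[ce ea]].
  exists e; last by rewrite ce.
  by apply: (HP _ _ (0, 0)%N e e Ha.1 Ha'.1) Ce => //; exact: lt_trans aa'.
(* By [H2lt] the set [H2] has at most one point; beyond it, every point of [H] carries a chain from
   [x] to [y]. *)
have [a0 a0P] : exists a0, forall a, H a -> a0 < a -> local_rel D a x y.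
  have [[a0 Ha0]|nH2] := pselect (exists a, H2 a).
    exists a0 => a Ha a0a; apply: contrapT => nl.
    by apply: (H2lt _ _ Ha0 _ a0a).
  by exists \bot => a Ha _; apply: contrapT => nl; apply: nH2; exists a.
pose H1 a := H a /\ a0 < a.
have /choice[r rP] m : exists a, H1 a /\ m < a.
  have [a Ha] := Hunb (Order.max m a0); rewrite gt_max => /andP[? ?].
  by exists a.
have H1P a : H1 a -> [/\ chain D a (N a).1.1 (N a).1.2 (N a).2,
    agree a ((N a).1.2 0%N) x & agree a ((N a).1.2 (N a).1.1) y].
  by move=> [Ha aa0]; exact: NP (a0P _ Ha aa0).
(* The coherent local chains are glued, the values at [b] being read off at the point [r b] above
   [b]. *)
pose n := (N (r \bot)).1.1.
pose U i b := (N (r b)).1.2 i b.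
pose W i b := (N (r b)).2 i b.
have NE a : H1 a -> (N a).1.1 = n.
  move=> H1a; have [[Hr _] r0] := rP \bot; have [a00 _ _ _] := Hcl _ H1a.1.
  by apply: (HP _ _ (1, n)%N \bot \bot Hr H1a.1).
have UE a i : H1 a -> agree a ((N a).1.2 i) (U i).
  move=> H1a b ba; have [H1r br] := rP b.
  have [[ca _] _ _] := H1P _ H1a; have [[cr _] _ _] := H1P _ H1r.
  by apply: (graphE (fun a b => (N a).1.2 i b) (2, i)%N _ _ _ _ H1a.1 H1r.1
    (ca i _ ba).1 (cr i _ br).1 ba br).
have WE a i : H1 a -> agree a ((N a).2 i) (W i).
  move=> H1a b ba; have [H1r br] := rP b.
  have [[ca _] _ _] := H1P _ H1a; have [[cr _] _ _] := H1P _ H1r.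
  by apply: (graphE (fun a b => (N a).2 i b) (3, i)%N _ _ _ _ H1a.1 H1r.1
    (ca i _ ba).2 (cr i _ br).2 ba br).
have U0 : U 0%N = x.
  by apply/funext => b; have [/H1P[_ + _] br] := rP b => /(_ _ br).
have Un : U n = y.
  apply/funext => b; have [H1r br] := rP b; have [_ _ /(_ _ br) <-] := H1P _ H1r.
  by rewrite (NE _ H1r).
have UD i : (i < n)%N -> D (U i) (U i.+1) (W i).
  move=> i_n; apply: Dcl => b; have [H1r br] := rP b.
  have [[_ cn] _ _] := H1P _ H1r; rewrite (NE _ H1r) in cn.
  move: (cn _ _ i_n br).
  by apply: near_rel_agree; apply: agreeC; apply: agree_le (ltW br) _;
    [exact: UE|exact: UE|exact: WE].
apply: Sy; rewrite -Un.
(* Membership in [S] passes along the glued chain from [x] to [y]; the inequality keeps the running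
   index within its length. *)
have : (n <= n)%N by [].
elim: {1 3}n => [|i IHi] i_n; first by rewrite U0.
exact: SD (IHi (ltnW i_n)) (UD _ i_n).
Qed.

End Diamond.

(** * Closure properties of Sigma^1_1 relations *)

Section Analytic.
Context {d : Order.disp_t} {K : bOrderType d}.
Implicit Types (a b c : K) (x y w : K -> K) (Q : (K -> K) -> (K -> K) -> Prop).

(** This concerns the whole space: a Borel domain [X] will be absorbed into the relation, so that
    links of [D] cannot leave [X]. *)
Definition analytic_rel Q := exists2 D, closed_rel D &
  forall x y, Q x y <-> exists w, D x y w.

Lemma closed_bounded_topology (C : set (gBaire K * gBaire K * gBaire K)) :
  closed C -> closed_rel (fun x y w : K -> K => C (x, y, w)).
Proof.
have nbhs_basic (x : gBaire K) A : nbhs x A -> exists a, basic_open x a `<=` A.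
  rewrite nbhsE => -[U [oU Ux] UA].
  have [a aU] := (oU : bounded_open U) x Ux.
  by exists a; exact: subset_trans UA.
move=> Ccl x y w near_w; apply: Ccl => B.
move=> [[A A'] /= [[[A1 A2] /= [nx ny] A12] nw] AA'].
have [a1 ax] := nbhs_basic _ _ nx; have [a2 ay] := nbhs_basic _ _ ny.
have [a3 aw] := nbhs_basic _ _ nw.
have [x' [y' [w' [xx yy ww Cx']]]] := near_w (Order.max a1 (Order.max a2 a3)).
exists (x', y', w'); split=> //; apply: AA'; split=> /=.
  apply: A12; split=> /=; [apply: ax|apply: ay] => b ba; apply/esym.
    by apply: xx; rewrite lt_max ba.
  by apply: yy; rewrite !lt_max ba orbT.
by apply: aw => b ba; apply/esym/ww; rewrite !lt_max ba !orbT.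
Qed.

Lemma analytic_basic (p : gBaire K) a : analytic_rel (fun x _ => basic_open p a x).
Proof.
exists (fun x _ _ => basic_open p a x) => [x y w nx b ba|x y].
  have [x' [_ [_ [xx _ _ px]]]] := nx a; by rewrite xx// px.
by split=> [px|[]//]; exists id.
Qed.

Lemma analytic_swap Q : analytic_rel Q -> analytic_rel (fun x y => Q y x).
Proof.
move=> [D Dcl QD]; exists (fun x y w => D y x w) => [x y w nD|x y]; last exact: QD.
by apply: Dcl => a; have [x' [y' [w' [? ? ? ?]]]] := nD a; exists y', x', w'.
Qed.

Hypothesis Kreg : regular_uncountable_cardinal K.

Lemma agree_comp (q : K -> K) a :
  exists m, forall w w', agree m w w' -> agree a (w \o q) (w' \o q).
Proof.
have [m [_ qm]] := segment_bounded Kreg a q.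
by exists m => w w' ww b ba /=; apply: ww; exact: qm.
Qed.

(** A single [w] stores a witness for every [a], as its section [w \o p a]; taking sections is
    continuous by [agree_comp]. *)
Lemma analytic_bigcap (Q : K -> (K -> K) -> (K -> K) -> Prop) :
  (forall a, analytic_rel (Q a)) -> analytic_rel (fun x y => forall a, Q a x y).
Proof.
move=> QA; have /choice[D DP] a : exists D, closed_rel D /\
    forall x y, Q a x y <-> exists w, D x y w by have [D] := QA a; exists D.
have [p [p1 [p2 pK]]] := unpairing Kreg.
exists (fun x y w => forall a, D a x y (w \o p a)) => [x y w nD a|x y].
  apply: (DP a).1 => b; have [m mP] := agree_comp (p a) b.
  have [x' [y' [w' [xx yy ww Dx']]]] := nD (Order.max m b).
  exists x', y', (w' \o p a); split; last exact: Dx'.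
  - by apply: agree_le xx; rewrite le_max lexx orbT.
  - by apply: agree_le yy; rewrite le_max lexx orbT.
  - by apply: mP; apply: agree_le ww; rewrite le_max lexx.
split=> [Qxy|[w Dw] a]; last by apply/(DP a).2; exists (w \o p a).
have /choice[W WP] a : exists w, D a x y w by apply/(DP a).2.
exists (fun c => W (p1 c) (p2 c)) => a.
suff -> : (fun c => W (p1 c) (p2 c)) \o p a = W a by [].
by apply/funext => b /=; have [-> ->] := pK a b.
Qed.

(** The witness stores the index as its value at [p \bot \bot] and a witness for that index in the
    section at [a1], which is disjoint from that position. Agreement beyond [p \bot \bot] fixes the
    index. *)
Lemma analytic_bigcup (Q : K -> (K -> K) -> (K -> K) -> Prop) :
  (forall a, analytic_rel (Q a)) -> analytic_rel (fun x y => exists a, Q a x y).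
Proof.
move=> QA; have /choice[D DP] a : exists D, closed_rel D /\
    forall x y, Q a x y <-> exists w, D x y w by have [D] := QA a; exists D.
have [p [p1 [p2 pK]]] := unpairing Kreg.
have [a1 a1P] := exists_gt Kreg \bot.
exists (fun x y w => D (w (p \bot \bot)) x y (w \o p a1)) => [x y w nD|x y].
  apply: (DP _).1 => b; have [m mP] := agree_comp (p a1) b.
  have [m' m'P] := exists_gt Kreg (p \bot \bot).
  have [x' [y' [w' [xx yy ww Dx']]]] := nD (Order.max m' (Order.max m b)).
  exists x', y', (w' \o p a1); split; last by rewrite ww// lt_max m'P.
  - by apply: agree_le xx; rewrite !le_max lexx !orbT.
  - by apply: agree_le yy; rewrite !le_max lexx !orbT.
  - by apply: mP; apply: agree_le ww; rewrite !le_max lexx orbT.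
split=> [[a /(DP a).2[w Dw]]|[w Dw]]; last first.
  by exists (w (p \bot \bot)); apply/(DP _).2; exists (w \o p a1).
exists (fun c => if p1 c == \bot then a else w (p2 c)).
have [-> _] := pK \bot \bot; rewrite eqxx.
suff -> : (fun c => if p1 c == \bot then a else w (p2 c)) \o p a1 = w by [].
by apply/funext => b /=; have [-> ->] := pK a1 b; rewrite gt_eqF.
Qed.

Lemma analytic_and Q Q' : analytic_rel Q -> analytic_rel Q' ->
  analytic_rel (fun x y => Q x y /\ Q' x y).
Proof.
move=> QA QA'; have [a1 a1P] := exists_gt Kreg \bot.
suff -> : (fun x y => Q x y /\ Q' x y) =
    (fun x y => forall a, (if a == \bot then Q else Q') x y).
  by apply: analytic_bigcap => a; case: eqP.
apply/funext => x; apply/funext => y; apply/propext.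
split=> [[? ?] a|QQ]; first by case: eqP.
by have := QQ a1; have := QQ \bot; rewrite eqxx gt_eqF.
Qed.

Lemma borel_analytic (X : set (gBaire K)) : borel X -> analytic_rel (fun x _ => X x).
Proof.
elim=> [p a|F _ IH|F _ IH]; first exact: analytic_basic.
  suff -> : (fun x (_ : K -> K) => (\bigcup_a F a) x) =
      (fun x _ => exists a, F a x) by exact: analytic_bigcup.
  by apply/funext => x; apply/funext => _; apply/propext; split=> [[a _ ?]|[a ?]]; exists a.
suff -> : (fun x (_ : K -> K) => (\bigcap_a F a) x) =
    (fun x _ => forall a, F a x) by exact: analytic_bigcap.
by apply/funext => x; apply/funext => _; apply/propext; split=> H a; [exact: H|move=> _; exact: H].
Qed.

End Analytic.

(** * Borel sets and the reduction *)

Section Completeness.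
Context {d : Order.disp_t} {K : bOrderType d}.
Implicit Types (a b c : K) (X U : set (gBaire K)).
Hypothesis Kwi : weakly_ineffable K.
Let Kreg := Kwi.1.

Lemma is_one_exists : exists a : K, is_one a.
Proof.
have [a a0] := exists_gt Kreg \bot; have [Kwo _ _ _] := Kreg.
have [m m0 mmin] := Kwo _ (ex_intro (fun b => \bot < b) a a0).
by exists m; split.
Qed.

Lemma borel_set0 : borel (set0 : set (gBaire K)).
Proof.
have [e [e0 _]] := is_one_exists.
(* The sets [F a] prescribe different values at [\bot], so their intersection is empty. *)
pose F a : set (gBaire K) := basic_open (fun=> a) e.
suff -> : set0 = \bigcap_a F a.
  by apply: borel_bigcap => a; exact: borel_basic.
apply/seteqP; split=> // x xF.
have xe : x \bot = e := xF e I _ e0; have x0 : x \bot = \bot := xF \bot I _ e0.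
by move: e0; rewrite -xe x0 ltxx.
Qed.

(** Guessing with the empty [D] yields that kappa^{<kappa} has size kappa. *)
Lemma restrictions_enumerable : exists g : K -> gBaire K,
  forall x a, exists b, agree a (g b) x.
Proof.
have [g gP] : exists g : K -> K -> K, forall x y, x <> y ->
    forall C, club C -> exists a, C a /\ agree a (g a) x.
  have F0 : closed_rel (fun _ _ _ : K -> K => False).
    by move=> x y w /(_ \bot)[? [? [? []]]].
  have [g gP] := diamond Kwi F0; exists g => x y xy C clubC.
  have [|||a [Ca gx _]] := gP x y [set x] _ _ _ _ clubC => //; last by exists a.
  by move=> yx; apply: xy.
exists g => x a; have [e [e0 _]] := is_one_exists.
(* Any [y] other than [x] serves as the target; this one is changed at [\bot]. *)
pose y b := if b == \bot then (if x \bot == \bot then e else \bot) else x b.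
have xy : x <> y.
  move=> /(congr1 (fun z : K -> K => z \bot)); rewrite /y eqxx.
  by case: eqP => [->|//]; move/eqP; rewrite lt_eqF.
have [Cunb Ccl] := closure_points_club Kreg id.
have clubC : club (closure_points id `&` [set b | a < b]).
  have -> : closure_points id `&` [set b | a < b] = [set b | a < b].
    apply/seteqP; split=> [b []//|b ab]; split=> //; split=> //.
    exact: le_lt_trans ab.
  split=> [[m mP]|b b0 bP].
    have [m' mm'] := exists_gt Kreg (Order.max m a).
    move: mm'; rewrite gt_max => /andP[mm' /mP]; by rewrite leNgt mm'.
  have [c ac /andP[_ cb]] := bP _ b0; exact: lt_trans cb.
have [b [[_ ab] gx]] := gP x y xy _ clubC.
by exists b; exact: agree_le (ltW ab) gx.
Qed.

Lemma borel_open U : open U -> borel U.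
Proof.
move=> oU; have [g gP] := restrictions_enumerable.
pose F a b := if pselect (basic_open (g a) b `<=` U) is left _
  then basic_open (g a) b else set0.
suff -> : U = \bigcup_a \bigcup_b F a b.
  apply: borel_bigcup => a; apply: borel_bigcup => b.
  by rewrite /F; case: pselect => _; [exact: borel_basic|exact: borel_set0].
apply/seteqP; split=> [x Ux|x [a _ [b _]]]; last first.
  by rewrite /F; case: pselect => // sU /sU.
have [b bU] := (oU : bounded_open U) x Ux; have [a ax] := gP x b.
exists a => //; exists b => //; rewrite /F; case: pselect => [_ c cb|[]].
  by rewrite ax.
by move=> y yg; apply: bU => c cb; rewrite yg// ax.
Qed.

Lemma borel_setI X U : borel X -> borel U -> borel (X `&` U).
Proof.
move=> bX bU; have [e [e0 _]] := is_one_exists.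
suff -> : X `&` U = \bigcap_(a : K) (if a == \bot then X else U).
  by apply: borel_bigcap => a; case: eqP.
apply/seteqP; split=> [x [? ?] a _|x H]; first by case: eqP.
by have := H e I; have := H \bot I; rewrite eqxx gt_eqF.
Qed.

Lemma borel_gCantor : borel (@gCantor _ K).
Proof.
suff -> : @gCantor _ K = \bigcap_a [set x | x a = \bot \/ is_one (x a)].
  apply: borel_bigcap => a; apply: borel_open.
  suff : bounded_open [set x : gBaire K | x a = \bot \/ is_one (x a)] by [].
  move=> x xa; have [b ab] := exists_gt Kreg a; exists b => y /= yx.
  by rewrite yx.
by apply/seteqP; split=> x H a; [move=> _; exact: H|exact: H].
Qed.

Lemma sub_NS_quasi_order : quasi_order_on (@gCantor _ K) (@sub_NS _ K).
Proof.
split=> [|x _|x y z _ _ _]; first exact: borel_gCantor.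
  by rewrite /sub_NS setDv; apply/(nonstationaryP Kreg); exists id; rewrite set0I.
move=> /(nonstationaryP Kreg)[h hxy] /(nonstationaryP Kreg)[h' hyz].
apply/(nonstationaryP Kreg); exists (fun b => Order.max (h b) (h' b)).
apply/seteqP; split=> // a [[xa za] /closure_points_max[ha h'a]].
have [ya|nya] := pselect (is_one (y a)); first by rewrite -hyz; split.
by rewrite -hxy; split.
Qed.

Lemma analytic_reducible_sub_NS X (Q : gBaire K -> gBaire K -> Prop) :
  quasi_order_on X Q -> Sigma11 X Q ->
  borel_reducible X Q (@gCantor _ K) (@sub_NS _ K).
Proof.
move=> [bX Qrefl Qtrans] [C Ccl QC].
(* Both arguments are forced into [X], where [Q] is transitive. *)
have [D Dcl QD] : analytic_rel (fun x y => X x /\ (X y /\ Q x y)).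
  suff -> : (fun x y : K -> K => X x /\ (X y /\ Q x y)) =
      (fun x y => X x /\ (X y /\ exists w, C (x, y, w))).
    apply: (analytic_and Kreg); first exact: (borel_analytic Kreg).
    apply: (analytic_and Kreg).
      exact: (analytic_swap (borel_analytic Kreg bX)).
    by eexists; first exact: closed_bounded_topology Ccl.
  apply/funext => x; apply/funext => y; apply/propext.
  by split=> -[Xx [Xy Qxy]]; do 2 split=> //; apply/QC.
have [g gP] := diamond Kwi Dcl; have [e e1] := is_one_exists.
pose f (x : gBaire K) : gBaire K :=
  fun a => if pselect (local_rel D a (g a) x) is left _ then e else \bot.
have fE x a : is_one (f x a) <-> local_rel D a (g a) x.
  rewrite /f; case: pselect => //= nl; split=> // -[]; by rewrite ltxx.
exists f => [|x y Xx Xy].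
  split=> [x _ a|U oU]; first by rewrite /f; case: pselect; [right|left].
  apply: borel_setI => //; apply: borel_open.
  (* The map [f] is continuous: [f x b] depends only on [x] below [b]. *)
  suff : bounded_open (f @^-1` U) by [].
  move=> x Ufx; have [a aU] := (oU : bounded_open U) _ Ufx.
  exists a => y yx; apply: aU => b ba.
  have xy : agree b x y by move=> c cb; rewrite yx//; exact: lt_trans ba.
  rewrite /f; case: pselect => [l|nl]; case: pselect => [l'|nl'] //.
    by exfalso; apply: nl'; apply: local_rel_agree (agreeC xy) l.
  by exfalso; apply: nl; apply: local_rel_agree xy l'.
split=> [Qxy|].
  have [w Dw] : exists w, D x y w by apply/QD.
  (* At closure points of [y] and of the witness [w], a chain from [g a] to [x] extends by one link
     to [y]. *)
  apply/(nonstationaryP Kreg); exists (fun b => Order.max (y b) (w b)).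
  apply/seteqP; split=> // a [[/= /fE lx nly] /closure_points_max[[_ ya] [_ wa]]].
  apply: nly; apply/fE; apply: local_rel_step Dw lx => b ba.
  by split; [exact: ya|exact: wa].
apply: contra_notP => nQ C' /closure_points_sub_club[h hC].
(* The club is refined to closure points of [x], where a correct guess is related to [x] by
   reflexivity. The set of [u] above [x] in [Q] separates [x] from [y]. *)
have [|||a] := gP x y [set u | X u /\ Q x u] _ _ _ _
  (closure_points_club Kreg (fun b => Order.max (h b) (x b))).
- by split=> //; exact: Qrefl.
- by move=> [].
- move=> u v w [Xu Qxu] Duvw; have [_ [Xv Quv]] : X u /\ (X v /\ Q u v).
    by apply/QD; exists w.
  by split=> //; exact: Qtrans Qxu Quv.
move=> [/closure_points_max[/hC Ca [_ xa]] gx nl]; exists a; split=> //.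
split=> /=; first by apply/fE; apply: local_rel_agree (agreeC gx) _ (local_rel_refl D xa).
by move=> /fE; apply: contra_not nl; exact: local_rel_agree.
Qed.

End Completeness.

Theorem theorem5p8 (d : Order.disp_t) (K : bOrderType d) :
  weakly_ineffable K -> Sigma11_complete (@gCantor d K) (@sub_NS d K).
Proof.
move=> Kwi; split; first exact: sub_NS_quasi_order.
by move=> X Q; exact: analytic_reducible_sub_NS.
Qed.
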